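(* If $G=(V,E)$ is a simple graph with $n$ vertices, no isolated vertices, and maximum degree $\Delta$, then $\Upsilon(G) \gtrsim n / \log \Delta$.
   Context: Graphs are finite. For a finite, simple graph $G=(V,E)$ and a subset $V' \subset V$, let $U(V')$ denote the subset of vertices in $G$ with a unique neighbor in $V'$ (that is, exactly one neighbor in $V'$). Define $\Upsilon(G) = \max\{ |U(V')| : V' \subset V\}$. An isolated vertex is a vertex of degree $0$, and the maximum degree is the maximum of the degrees of the vertices of $G$. For functions $A$, $B$ of several variables, $A \lesssim B$ means that $A \le C \cdot B$ for some absolute constant $C$, and $A \gtrsim B$ means $B \lesssim A$. *)

(* Defs.v *)
From mathcomp Require Import all_boot.

Set Implicit Arguments.
Unset Strict Implicit.
Unset Printing Implicit Defensive.

Definition simple_graph (T : finType) (e : rel T) : Prop :=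
  symmetric e /\ irreflexive e.

Definition vertex_nbrs (T : finType) (e : rel T) (x : T) : {set T} :=
  [set y | e x y].

Definition vertex_degree (T : finType) (e : rel T) (x : T) : nat :=
  #|vertex_nbrs e x|.

Definition isolated_vertex (T : finType) (e : rel T) (x : T) : bool :=
  vertex_degree e x == 0.

(* Equal to 0 for the graph without vertices. *)
Definition max_degree (T : finType) (e : rel T) : nat :=
  \max_(x : T) vertex_degree e x.

(* The vertex x ranges over the whole graph: it may or may not lie in A. *)
Definition unique_nbr_set (T : finType) (e : rel T) (A : {set T}) : {set T} :=
  [set x | #|vertex_nbrs e x :&: A| == 1].

Definition Upsilon (T : finType) (e : rel T) : nat :=
  \max_(A : {set T}) #|unique_nbr_set e A|.

(* Main.v *)
Require Import Defs.
From HB Require Import structures.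
From mathcomp Require Import all_boot all_order all_algebra.
From mathcomp Require Import all_classical all_reals all_analysis.
From mathcomp Require Import fintype finset zify.
Import Order.TTheory GRing.Theory Num.Theory.
Set Implicit Arguments.
Unset Strict Implicit.

(** A random vertex set that contains each vertex independently with
    probability [p] meets a neighbourhood of size [d] exactly once with
    probability bounded below as soon as [d * p] is bounded away from [0] and
    from [1].  A single [p] therefore serves all vertices whose degree lies in
    one dyadic interval [2 ^ i <= d < 2 ^ i.+1], and averaging over the random set
    gives a set whose uniquely adjacent vertices are at least one eighth as many
    as that interval's vertices ([degree_window_le_Upsilon]).  All degrees are
    positive, so about [log2 Delta] dyadic intervals cover the graph, and
    summing over them bounds [n] by a multiple of [Upsilon * log Delta]
    ([card_le_Upsilon_trunc_log]).

    Probabilities are counted: the random set is the class of a fixed colour in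
    a uniform colouring of the vertices by [#|K|] colours, so that
    [p = 1 / #|K|].  First and second moments suffice, because the size [k] of
    the intersection with a neighbourhood satisfies [2 * k <= (k == 1) + k ^ 2]. *)

Section ColourClass.

Variables (T K : finType) (c : K).
Implicit Types (f : {ffun T -> K}) (D N A : {set T}).

Definition colour_class f : {set T} := [set x | f x == c].

Lemma card_colour_class_supset D :
  #|[set f | D \subset colour_class f]| * #|K| ^ #|D| = #|K| ^ #|T|.
Proof.
pose F x := if x \in D then pred1 c else predT.
have -> : #|[set f | D \subset colour_class f]| = #|family F|.
  apply: eq_card => f; rewrite inE; apply/subsetP/familyP => sD x.
    rewrite /F; case: ifP => // xD.
    by have := sD x xD; rewrite inE.
  by move=> xD; have := sD x; rewrite /F xD !inE.
rewrite card_family foldrE big_map big_enum /= (bigID (mem D)) /=.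
rewrite big1 ?mul1n; last by move=> x xD; rewrite /F xD card1.
rewrite (eq_bigr (fun=> #|K|)); last by move=> x /negbTE xD; rewrite /F xD.
by rewrite prod_nat_const -expnD addnC -(cardC (mem D)).
Qed.

Lemma card_setI_sum N A : #|N :&: A| = \sum_(y in N) (y \in A).
Proof.
rewrite -sum1_card big_mkcond [RHS]big_mkcond /=.
by apply: eq_bigr => y _; rewrite inE; case: (y \in N); case: (y \in A).
Qed.

Lemma sum_subset_colour_class D :
  \sum_f (D \subset colour_class f) = #|[set f | D \subset colour_class f]|.
Proof.
rewrite -sum1_card [RHS]big_mkcond /=.
by apply: eq_bigr => f _; rewrite inE; case: ifP.
Qed.

Lemma sum_card_colour_class N :
  #|K| * (\sum_f #|N :&: colour_class f|) = #|N| * #|K| ^ #|T|.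
Proof.
under eq_bigr do rewrite card_setI_sum.
rewrite exchange_big big_distrr -sum_nat_const /=; apply: eq_bigr => y _.
under eq_bigr do rewrite -sub1set.
by rewrite sum_subset_colour_class -(card_colour_class_supset [set y]) cards1
           mulnC.
Qed.

(** Distinct vertices receive the colour [c] independently; the diagonal pairs
    contribute the extra summand [#|K|]. *)
Lemma sum_card_colour_class_sqr N :
  #|K| ^ 2 * (\sum_f #|N :&: colour_class f| ^ 2)
    <= #|N| * (#|K| + #|N|) * #|K| ^ #|T|.
Proof.
have pairE f : #|N :&: colour_class f| ^ 2 =
    \sum_(y in N) \sum_(z in N) ([set y; z] \subset colour_class f).
  rewrite -mulnn {1}card_setI_sum big_distrl /=; apply: eq_bigr => y _.
  rewrite card_setI_sum big_distrr /=; apply: eq_bigr => z _.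
  by rewrite subUset !sub1set mulnb.
under eq_bigr do rewrite pairE.
rewrite exchange_big big_distrr -mulnA -sum_nat_const /=.
apply: leq_sum => y yN.
rewrite exchange_big (bigD1 y) //= mulnDr mulnDl; apply: leq_add.
  rewrite sum_subset_colour_class -(card_colour_class_supset [set y; y]).
  by rewrite setUid cards1 expn1 -mulnn -mulnA [_ * #|K|]mulnC.
rewrite big_distrr /= -sum_nat_const big_mkcondr /=.
apply: leq_sum => z zN; case: eqP => // /eqP zy.
rewrite sum_subset_colour_class -(card_colour_class_supset [set y; z]).
by rewrite cards2 eq_sym zy mulnC.
Qed.

(** For [t = #|N| / #|K|], between [1/4] and [1/2], the two moments bound the
    probability from below by [2 * t - (t + t ^ 2) = t - t ^ 2 >= 1/8]. *)
Lemma card_unique_colour_ge N :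
  #|N|.*2 <= #|K| <= 4 * #|N| ->
  #|K| ^ #|T| <= 8 * \sum_f (#|N :&: colour_class f| == 1).
Proof.
move=> /andP[leNK leKN].
have moments : 2 * (\sum_f #|N :&: colour_class f|) <=
    \sum_f (#|N :&: colour_class f| == 1) + \sum_f #|N :&: colour_class f| ^ 2.
  rewrite big_distrr -big_split; apply: leq_sum => f _ /=.
  by case: #|_| => [|[|k]] //=; nia.
have K_gt0 : 0 < #|K| by apply/card_gt0P; exists c.
have := sum_card_colour_class N; have := sum_card_colour_class_sqr N.
move: moments.
set S1 := \sum_f #|_|; set S2 := \sum_f _ ^ 2; set X := \sum_f _.
move: (#|K| ^ #|T|) => P; move: #|K| #|N| leNK leKN K_gt0 => m d.
rewrite -mul2n => le1 le2 m0 mom S2le S1E.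
have step : d * m * P <= m ^ 2 * X + d * d * P.
  have : m ^ 2 * (2 * S1) <= m ^ 2 * (X + S2) by rewrite leq_mul2l mom orbT.
  have : m ^ 2 * (2 * S1) = 2 * (d * m * P).
    by rewrite -mulnn -!mulnA [m * (2 * _)]mulnCA S1E; lia.
  by nia.
have half : 2 * (d * d * P) <= d * m * P by nia.
have quarter : m * m * P <= 4 * (d * m * P) by nia.
have : m * m * P <= m * m * (8 * X) by lia.
by rewrite leq_pmul2l // muln_gt0 m0.
Qed.

End ColourClass.

Lemma unique_nbr_set_le_Upsilon (T : finType) (e : rel T) (A : {set T}) :
  #|unique_nbr_set e A| <= Upsilon e.
Proof. exact: (leq_bigmax A). Qed.

(** Averaging over the colourings: each vertex of [W] is uniquely adjacent to
    the colour class for at least one eighth of them. *)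
Lemma degree_window_le_Upsilon (T : finType) (e : rel T) (W : {set T}) m :
  {in W, forall x, (vertex_degree e x).*2 <= m.+1 <= 4 * vertex_degree e x} ->
  #|W| <= 8 * Upsilon e.
Proof.
move=> degW; pose K := 'I_m.+1; pose c : K := ord0.
have cardF : #|{ffun T -> K}| = #|K| ^ #|T| by exact: card_ffun.
have F_gt0 : 0 < #|K| ^ #|T| by rewrite expn_gt0 card_ord.
rewrite -(leq_pmul2r F_gt0).
rewrite -{1}sum_nat_const.
apply: (@leq_trans (\sum_(x in W) 8 *
    \sum_(f : {ffun T -> K}) (x \in unique_nbr_set e (colour_class c f)))).
  apply: leq_sum => x xW.
  under eq_bigr do rewrite inE.
  by apply: card_unique_colour_ge; rewrite card_ord; exact: degW.
rewrite -big_distrr exchange_big /= -mulnA leq_mul2l /= mulnC -cardF.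
rewrite -sum_nat_const; apply: leq_sum => f _.
rewrite -card_setI_sum.
exact: leq_trans (subset_leq_card (subsetIr _ _))
                 (unique_nbr_set_le_Upsilon _ _).
Qed.

Lemma card_le_Upsilon_trunc_log (T : finType) (e : rel T) :
  (forall x : T, ~~ isolated_vertex e x) ->
  #|T| <= 8 * Upsilon e * (trunc_log 2 (max_degree e)).+1.
Proof.
move=> noniso; pose L := trunc_log 2 (max_degree e).
have log_lt x : trunc_log 2 (vertex_degree e x) < L.+1.
  by rewrite ltnS; apply: leq_trunc_log; exact: leq_bigmax.
pose cls x : 'I_L.+1 := Ordinal (log_lt x).
rewrite -sum1_card (partition_big cls xpredT) //= mulnC.
have := sum_nat_const 'I_L.+1 (8 * Upsilon e); rewrite card_ord => <-.
apply: leq_sum => i _.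
rewrite sum1_card -[#|_|]cardsE.
(* With [2 ^ i <= d < 2 ^ i.+1], taking [2 ^ i.+2] colours puts the expected
   number of coloured neighbours between 1/4 and 1/2. *)
apply: (@degree_window_le_Upsilon _ _ _ (2 ^ i.+2).-1) => x.
rewrite inE => /eqP xi.
have d_gt0 : 0 < vertex_degree e x by rewrite lt0n; exact: noniso.
have /andP[] := trunc_log_bounds (isT : 1 < 2) d_gt0.
have -> : trunc_log 2 (vertex_degree e x) = i by rewrite -xi.
by rewrite prednK ?expn_gt0 // !expnS; lia.
Qed.

Local Open Scope ring_scope.

Lemma trunc_log2_le_ln (R : realType) (m : nat) : (0 < m)%N ->
  (trunc_log 2 m)%:R * ln (2 : R) <= ln (m%:R : R).
Proof.
move=> m_gt0; rewrite mulrC mulr_natr -lnXn ?ltr0n // -natrX.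
by rewrite ler_ln ?posrE ?ltr0n ?expn_gt0 // ler_nat trunc_logP.
Qed.

Theorem theorem3 (R : realType) :
  exists C : R, 0 < C /\
    forall (T : finType) (e : rel T) (n Delta : nat),
      simple_graph e ->
      #|T| = n ->
      (forall x : T, ~~ isolated_vertex e x) ->
      max_degree e = Delta ->
      n%:R / ln (Delta%:R : R) <= C * (Upsilon e)%:R.
Proof.
have ln2_gt0 : 0 < ln (2 : R) by rewrite ln_gt0 // ltr1n.
(* The 16 is the 8 of the averaging bound times the 2 in
   [trunc_log 2 Delta + 1 <= 2 * trunc_log 2 Delta]. *)
exists (16 / ln 2); split; first by rewrite divr_gt0 // ltr0n.
move=> T e n Delta _ <- noniso <-.
have Cge0 : 0 <= 16 / ln 2 * (Upsilon e)%:R :> R.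
  by rewrite mulr_ge0 ?ler0n // divr_ge0 ?ler0n // ltW.
have [D2|D2] := leqP 2 (max_degree e); last first.
  (* [ln 0 = ln 1 = 0], and division by 0 gives 0. *)
  have -> : ln ((max_degree e)%:R : R) = 0.
    by case: (max_degree e) D2 => [|[|]] // _; rewrite ?ln1 ?ln0.
  by rewrite invr0 mulr0.
have lnD_gt0 : 0 < ln ((max_degree e)%:R : R) by rewrite ln_gt0 // ltr1n.
rewrite ler_pdivrMr // -(ler_pM2r ln2_gt0).
rewrite [leRHS]mulrAC [_ / _ * _ * _]mulrAC divfK ?gt_eqF //.
have log_ge1 : (1 <= trunc_log 2 (max_degree e))%N by rewrite trunc_log_gt0.
apply: (@le_trans _ _ ((16 * Upsilon e)%:R *
    ((trunc_log 2 (max_degree e))%:R * ln 2))); last first.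
  rewrite natrM ler_wpM2l ?mulr_ge0 ?ler0n //.
  by apply: trunc_log2_le_ln; exact: ltnW.
rewrite mulrA ler_wpM2r ?(ltW ln2_gt0) // -natrM ler_nat.
by apply: leq_trans (card_le_Upsilon_trunc_log noniso) _; nia.
Qed.
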